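(* Let $A\in\mathbb{R}^{n\times n}$, $B\in\mathbb{R}^{n\times m}$, $C\in\mathbb{R}^{p\times n}$ be such that $(A,B)$ is stabilizable and $(A,C)$ is observable. Let $L\in\mathbb{R}^{n\times p}$ be such that $\Lambda(s)=\det(sI-A+LC)$ is Hurwitz. Let $R=R^T>0$ and $Q_y=Q_y^T\in\mathbb{R}^{p\times p}$ with $Q_y>0$. Let $M$, $A_\zeta$, $B_\zeta$ be the matrices associated with $(A,B,C,L)$ as defined in the context, and let $Q_\zeta=M^TC^TQ_yCM$. Then the algebraic Riccati equation $$A_\zeta^TP_\zeta^*+P_\zeta^*A_\zeta+Q_\zeta-P_\zeta^*B_\zeta R^{-1}B_\zeta^TP_\zeta^*=0$$ admits a unique (symmetric) positive semi-definite solution $P_\zeta^*$, and it is given by $P_\zeta^*=M^TP^*M\ge 0$, where $P^*$ is the unique positive definite solution of $$A^TP^*+P^*A+C^TQ_yC-P^*BR^{-1}B^TP^*=0.$$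
   Context: Let $\Lambda(s)=\det(sI-A+LC)=s^n+\alpha_{n-1}s^{n-1}+\cdots+\alpha_1 s+\alpha_0$ (Hurwitz means that all its roots have negative real part), and let $D_0,\dots,D_{n-1}\in\mathbb{R}^{n\times n}$ be the constant matrices with $(sI-A+LC)^{-1}=\frac{1}{\Lambda(s)}\sum_{j=0}^{n-1}D_js^j$. For $i=1,\dots,m$ let $f_i$ be the $i$-th column of $B$, and for $i=m+1,\dots,m+p$ let $f_i$ be the $(i-m)$-th column of $L$. Set $M_i=[D_0f_i,\dots,D_{n-1}f_i]\in\mathbb{R}^{n\times n}$ and $M=[M_1,\dots,M_{m+p}]\in\mathbb{R}^{n\times(m+p)n}$. Let $\mathcal{A}\in\mathbb{R}^{n\times n}$ be the companion matrix with ones on the first superdiagonal, last row $(-\alpha_0,-\alpha_1,\dots,-\alpha_{n-1})$ and zeros elsewhere, and $b=(0,\dots,0,1)^T\in\mathbb{R}^n$. With $\otimes$ the Kronecker product and $\mathbf{0}$ zero blocks of compatible size, $$A_\zeta=(I_{m+p}\otimes\mathcal{A})+\begin{bmatrix}\mathbf{0}\\ I_p\otimes b\end{bmatrix}CM,\qquad B_\zeta=\begin{bmatrix}I_m\otimes b\\ \mathbf{0}\end{bmatrix},$$ so $A_\zeta$ is $(m+p)n\times(m+p)n$ and $B_\zeta$ is $(m+p)n\times m$. *)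

(* Defs.v *)
From mathcomp Require Import all_boot all_order all_algebra.
From mathcomp Require Export reals complex mxtens.

Set Implicit Arguments.
Unset Strict Implicit.
Unset Printing Implicit Defensive.

Import GRing.Theory Num.Theory.
Local Open Scope ring_scope.

Definition posdefmx (R : realType) n (P : 'M[R]_n) : Prop :=
  P^T = P /\ forall x : 'cV[R]_n, x != 0 -> 0 < (x^T *m P *m x) 0 0.

Definition possemidefmx (R : realType) n (P : 'M[R]_n) : Prop :=
  P^T = P /\ forall x : 'cV[R]_n, 0 <= (x^T *m P *m x) 0 0.

Definition hurwitz (R : realType) (q : {poly R}) : Prop :=
  forall z : R[i], root (map_poly (real_complex R) q) z -> complex.Re z < 0.

Definition stabilizable (R : realType) n m
    (A : 'M[R]_n) (B : 'M[R]_(n, m)) : Prop :=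
  exists K : 'M[R]_(m, n), hurwitz (char_poly (A - B *m K)).

Definition observability_mx (R : realType) n p
    (A : 'M[R]_n) (C : 'M[R]_(p, n)) : 'M[R]_(\sum_(i < n) p, n) :=
  \mxcol_(i < n) (C *m A ^+ i).

Definition observable (R : realType) n p
    (A : 'M[R]_n) (C : 'M[R]_(p, n)) : Prop :=
  \rank (observability_mx A C) = n.

Definition riccati (R : realType) n m (A : 'M[R]_n) (B : 'M[R]_(n, m))
    (Q : 'M[R]_n) (W : 'M[R]_m) (P : 'M[R]_n) : Prop :=
  A^T *m P + P *m A + Q - P *m B *m invmx W *m B^T *m P = 0.

(* [char_poly F] is det(sI - F), so this is det(sI - A + LC). *)
Definition observer_poly (R : realType) n p (A : 'M[R]_n) (C : 'M[R]_(p, n))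
    (L : 'M[R]_(n, p)) : {poly R} :=
  char_poly (A - L *m C).

(* The identity at all real s outside the finitely many roots of Lambda
   determines the D_j uniquely. *)
Definition resolvent_coeffs (R : realType) n p (A : 'M[R]_n)
    (C : 'M[R]_(p, n)) (L : 'M[R]_(n, p)) (D : 'I_n -> 'M[R]_n) : Prop :=
  forall s : R, (observer_poly A C L).[s] != 0 ->
    invmx (s%:M - A + L *m C) =
    ((observer_poly A C L).[s])^-1 *: \sum_(j < n) s ^+ j *: D j.

(* The columns of [row_mx B L] are f_1, ..., f_(m+p).  Column l = i * n + j
   of M, i.e. [mxtens_unindex l = (i, j)], is D_j f_i. *)
Definition param_mx (R : realType) n m p (B : 'M[R]_(n, m))
    (L : 'M[R]_(n, p)) (D : 'I_n -> 'M[R]_n) : 'M[R]_(n, (m + p) * n) :=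
  \matrix_(k, l) (D (mxtens_unindex l).2
                    *m col (mxtens_unindex l).1 (row_mx B L)) k 0.

(* Unlike [companionmx], of size n by construction (for q of degree n). *)
Definition companion (R : realType) n (q : {poly R}) : 'M[R]_n :=
  \matrix_(i, j) if i.+1 == n then - q`_j else (i.+1 == j :> nat)%:R.

Definition last_col (R : realType) n : 'cV[R]_n :=
  \col_i (i.+1 == n)%:R.

(* [*t] is the Kronecker product; the casts only identify (m + p) * n with
   m * n + p * n and k * 1 with k. *)
Definition B_zeta (R : realType) n m p : 'M[R]_((m + p) * n, m) :=
  castmx (esym (mulnDl m p n), muln1 m)
    (col_mx ((1%:M : 'M[R]_m) *t last_col R n) (0 : 'M[R]_(p * n, m * 1))).

Definition zeta_out (R : realType) n m p : 'M[R]_((m + p) * n, p) :=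
  castmx (esym (mulnDl m p n), muln1 p)
    (col_mx (0 : 'M[R]_(m * n, p * 1)) ((1%:M : 'M[R]_p) *t last_col R n)).

Definition A_zeta (R : realType) n m p (A : 'M[R]_n) (B : 'M[R]_(n, m))
    (C : 'M[R]_(p, n)) (L : 'M[R]_(n, p)) (D : 'I_n -> 'M[R]_n) :
    'M[R]_((m + p) * n) :=
  (1%:M : 'M[R]_(m + p)) *t companion n (observer_poly A C L)
  + zeta_out R n m p *m (C *m param_mx B L D).

Definition Q_zeta (R : realType) n m p (B : 'M[R]_(n, m))
    (C : 'M[R]_(p, n)) (L : 'M[R]_(n, p)) (D : 'I_n -> 'M[R]_n)
    (Qy : 'M[R]_p) : 'M[R]_((m + p) * n) :=
  (param_mx B L D)^T *m C^T *m Qy *m C *m param_mx B L D.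

(* Main.v *)
Require Import Defs.
From mathcomp Require Import all_boot all_order all_algebra.
From mathcomp Require Import spectral sesquilinear.
From mathcomp Require Import boolp topology normedtype sequences.
From mathcomp Require Import ring lra.

(** Write F = A - L C, which is Hurwitz.  Two facts reduce the large Riccati
    equation to the small one.

    The matrix M intertwines the two systems: M A_zeta = A M and M B_zeta = B.
    Indeed, comparing powers of s in (s I - F) (sum_j D_j s^j) = Lambda(s) I
    gives D_(j-1) = F D_j + alpha_j I and D_(n-1) = I
    ([resolvent_recursion]).  The first relation says that M carries the
    block-diagonal companion matrix to F; the second says that M sends the
    driven coordinates of the blocks to the columns of B and of L.  Hence
    M^T P M solves the large equation as soon as P solves the small one.

    Both equations have at most one positive semidefinite solution, because
    both pairs are detectable through an explicit output injection: A - L C is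
    Hurwitz by assumption, and A_zeta minus its output injection of C M is
    block diagonal with companion blocks of characteristic polynomial Lambda.
    Detectability forces every positive semidefinite solution to be stabilizing
    ([riccati_stabilizing], an eigenvector argument), and the difference of two
    stabilizing solutions satisfies a homogeneous Sylvester equation whose two
    coefficients are Hurwitz, so it vanishes ([riccati_unique]).

    A solution P of the small equation is obtained by policy iteration
    (Kleinman): starting from a stabilizing gain, alternately solve the
    Lyapunov equation giving the cost of the current gain, and replace the gain
    by the one that is optimal for this cost.  Each gain is again stabilizing
    and the costs decrease in the semidefinite order ([policy_improvement]), so
    they converge entrywise, and the limit solves the Riccati equation
    ([riccati_exists]).  The kernel of P is A-invariant and contained in the
    kernel of C, so observability makes P positive definite
    ([riccati_posdef]).

    The underlying tool is Lyapunov's theorem: if F is Hurwitz and N >= 0, a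
    symmetric P with F^T P + P F + N = 0 is positive semidefinite
    ([lyapunov_psd]).  It is proved without matrix exponentials.  A Schur form
    of F, rescaled by a geometric diagonal matrix, is so close to diagonal that
    its whole numerical range lies in the open left half-plane
    ([stable_numrange]); in these coordinates an eigenvector of P for a
    negative eigenvalue would contradict the Lyapunov equation. *)

Set Implicit Arguments.
Unset Strict Implicit.
Unset Printing Implicit Defensive.

Import Order.TTheory GRing.Theory Num.Theory.
Import numFieldNormedType.Exports.
Local Open Scope ring_scope.

(** * Lyapunov's theorem over a closed field *)

Section Complex.
Variable C : numClosedFieldType.
Local Open Scope sesquilinear_scope.

Lemma pos_lower_bound n (f : 'I_n -> C) :
  (forall i, 0 < f i) -> exists2 e : C, 0 < e & forall i, e <= f i.
Proof.
move=> f0; have s0 : 0 <= \sum_i (f i)^-1 by apply: sumr_ge0 => i _; rewrite invr_ge0 ltW.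
exists (1 + \sum_i (f i)^-1)^-1; first by rewrite invr_gt0 ltr_wpDr.
move=> i; rewrite -[leRHS]invrK lef_pV2 ?posrE ?invr_gt0 ?ltr_wpDr//.
rewrite (bigD1 i)//= addrCA lerDl addr_ge0// sumr_ge0// => j _.
by rewrite invr_ge0 ltW.
Qed.

Lemma addCJ_le_norm (a : C) : a + a^* <= `|a| *+ 2.
Proof.
apply: le_trans (real_ler_norm _) _.
  by rewrite CrealE rmorphD /= conjCK addrC.
by rewrite (le_trans (ler_normD _ _))// norm_conjC mulr2n.
Qed.

Lemma sesqui_form_sum n (A : 'M[C]_n) (x : 'cV[C]_n) :
  (x^t* *m A *m x) 0 0 = \sum_i \sum_j (x i 0)^* * A i j * x j 0.
Proof.
rewrite mxE exchange_big /=; apply: eq_bigr => j _.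
by rewrite mxE mulr_suml; apply: eq_bigr => i _; rewrite !mxE.
Qed.

Lemma sesqui_formJ n (A : 'M[C]_n) (x : 'cV[C]_n) :
  ((x^t* *m A *m x) 0 0)^* = (x^t* *m A^t* *m x) 0 0.
Proof.
transitivity ((x^t* *m A *m x)^t* 0 0); first by rewrite [RHS]mxE [in RHS]mxE.
by rewrite !trmx_mul !map_mxM trmxCK mulmxA.
Qed.

(** Conjugation by diag(1, r, r^2, ...) multiplies the (i, j) entry, j < i, of a
    lower triangular matrix by r^(i-j).  For small r the off-diagonal part is
    dominated by the real parts of the diagonal entries. *)
Lemma trig_scaled_numrange n (T : 'M[C]_n) :
    is_trig_mx T -> (forall i, T i i + (T i i)^* < 0) ->
  exists2 d : 'I_n -> C, forall i, 0 < d i &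
    forall x : 'cV[C]_n, x != 0 ->
    let q := (x^t* *m (\matrix_(i, j) (d i * T i j / d j)) *m x) 0 0 in
    q + q^* < 0.
Proof.
move=> /is_trig_mxP trT negT.
have [|e e0 eT] := @pos_lower_bound n (fun i => - (T i i + (T i i)^*)).
  by move=> i; rewrite oppr_gt0.
(* The ratio r is chosen so that r <= 1 and 2 r c < e. *)
pose c := \sum_i \sum_j `|T i j|.
have c0 : 0 <= c by apply: sumr_ge0 => i _; apply: sumr_ge0 => j _.
pose r := e / (c *+ 2 + 1 + e).
have den0 : 0 < c *+ 2 + 1 + e by rewrite addr_gt0// ltr_wpDl// mulrn_wge0.
have r0 : 0 < r by rewrite divr_gt0.
have r1 : r <= 1 by rewrite ler_pdivrMr// mul1r lerDr addr_ge0// mulrn_wge0.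
have rc : r * c *+ 2 < e.
  rewrite -mulrnAr -mulrA [_^-1 * _]mulrC gtr_pMr// ltr_pdivrMr// mul1r.
  by rewrite -addrA ltrDl addr_gt0.
exists (fun i => r ^+ i) => [i|x x0]; first by rewrite exprn_gt0.
pose S := \sum_i `|x i 0| ^+ 2.
have xS i : `|x i 0| ^+ 2 <= S.
  by rewrite /S (bigD1 i)//= lerDl sumr_ge0// => j _; rewrite exprn_ge0.
have S0 : 0 < S.
  have [i xi0] : exists i, x i 0 != 0.
    apply/existsP; apply: contraNT x0 => /existsPn x0.
    by apply/eqP/colP => i; rewrite mxE; apply/eqP; move: (x0 i); rewrite negbK.
  by apply: lt_le_trans (xS i); rewrite exprn_gt0// normr_gt0.
have xxS i j : `|x i 0| * `|x j 0| <= S.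
  have [xij|/ltW xij] := real_leP (normr_real (x i 0)) (normr_real (x j 0)).
    by apply: le_trans (xS j); rewrite expr2 ler_wpM2r.
  by apply: le_trans (xS i); rewrite expr2 ler_wpM2l.
cbv zeta; rewrite sesqui_form_sum; under eq_bigr do under eq_bigr do rewrite mxE.
rewrite rmorph_sum -big_split /=.
under eq_bigr do rewrite rmorph_sum -big_split /=.
apply: (@le_lt_trans _ _ (- e * S + r * c * S *+ 2)); last first.
  by rewrite -mulrnAl -mulrDl pmulr_llt0// addrC subr_lt0.
(* Spread the bound over the entries of T, so as to compare termwise. *)
have -> : - e * S + r * c * S *+ 2 =
    \sum_i \sum_j ((i == j)%:R * (- e * `|x i 0| ^+ 2) + r * `|T i j| * S *+ 2).
  under eq_bigr => i _.
    rewrite big_split /= (bigD1 i)//= eqxx mul1r big1 ?addr0; last first.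
      by move=> j; rewrite eq_sym => /negPf ->; rewrite mul0r.
    over.
  rewrite big_split /= -mulr_sumr; congr (_ + _).
  rewrite [r * c]mulr_sumr mulr_suml -sumrMnl; apply: eq_bigr => i _.
  by rewrite [r * _]mulr_sumr mulr_suml -sumrMnl; apply: eq_bigr => j _.
apply: ler_sum => i _; apply: ler_sum => j _.
have rTS k : 0 <= r * `|T i k| * S.
  by rewrite mulr_ge0 ?(ltW S0)// mulr_ge0 ?(ltW r0).
have ri k : r ^+ k != 0 by rewrite expf_neq0// gt_eqF.
have [<-|neq_ij] := eqVneq i j.
  have -> : r ^+ i * T i i / r ^+ i = T i i by rewrite mulrAC divff ?mul1r.
  rewrite mul1r -[leLHS]addr0 lerD ?mulrn_wge0 ?rTS//.
  have -> : (x i 0)^* * T i i * x i 0 = T i i * (x i 0 * (x i 0)^*).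
    by rewrite [RHS]mulrA mulrC mulrA mulrC mulrA.
  rewrite !rmorphM /= conjCK [(x i 0)^* * _]mulrC -mulrDl normCK.
  by rewrite ler_wpM2r// ?mul_conjC_ge0// -[leLHS]opprK lerN2.
rewrite mul0r add0r; have [ltij|ltji|/val_inj eqij] := ltngtP i j; last first.
- by rewrite eqij eqxx in neq_ij.
- apply: le_trans (addCJ_le_norm _) _; rewrite lerMn2r/=.
  have -> : r ^+ i * T i j / r ^+ j = r ^+ (i - j) * T i j.
    by rewrite -{1}(subnK (ltnW ltji)) exprD mulrAC -!mulrA [r ^+ j * _]mulrA
      divff ?mul1r.
  rewrite !normrM norm_conjC mulrAC mulrC ler_pM// ?mulr_ge0//.
  rewrite ler_wpM2r// normrX gtr0_norm//.
  rewrite -[leRHS]expr1 ler_wiXn2l ?(ltW r0)// subn_gt0 //.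
- rewrite trT// !(mulr0,mul0r) conjC0 addr0 normr0 mulr0 mul0r mul0rn //.
Qed.

(** Over the closed field, Schur triangularization followed by the diagonal
    scaling brings the numerical range into the open left half-plane.  Being a
    statement on all vectors, this is the form of stability that can be applied
    to an eigenvector of a matrix other than F. *)
Lemma stable_numrange n (F : 'M[C]_n) :
    (forall a, root (char_poly F) a -> a + a^* < 0) ->
  exists2 W : 'M[C]_n, W \in unitmx &
    forall x : 'cV[C]_n, x != 0 ->
    let q := (x^t* *m (W *m F *m invmx W) *m x) 0 0 in q + q^* < 0.
Proof.
move=> rootF; have [n0|n_gt0] := posnP n.
  exists 1%:M => [|x]; first exact: unitmx1.
  by case/negP; apply/eqP/matrixP => k; have := ltn_ord k; rewrite {2}n0.
have [P /unitarymx_unit uP trT] := Schur F n_gt0.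
rewrite /similar_to conjumx// in trT.
set T := P *m F *m invmx P in trT.
have [i|d d0 dT] := trig_scaled_numrange trT.
  apply: rootF; rewrite -eigenvalue_root_char.
  have /eigenvalueP[v vT v0] : eigenvalue T (T i i).
    by rewrite eigenvalue_root_char char_poly_trig// (bigD1 i)//= rootM root_XsubC eqxx.
  apply/eigenvalueP; exists (v *m P).
    by rewrite scalemxAl -vT /T !mulmxA mulmxKV.
  by apply: contraNneq v0 => vP0; rewrite -(mulmxK uP v) vP0 mul0mx.
pose D := diag_mx (\row_i d i); pose D' := diag_mx (\row_i (d i)^-1).
have D'D : D' *m D = 1%:M.
  rewrite mulmx_diag -diag_const_mx; congr diag_mx.
  by apply/rowP => i; rewrite !mxE mulVf ?gt_eqF.
have [uD' uD] := mulmx1_unit D'D.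
exists (D *m P) => [|x x0]; first by rewrite unitmx_mul uD.
suff -> : D *m P *m F *m invmx (D *m P)
       = \matrix_(i, j) (d i * T i j / d j) by exact: dT.
have -> : \matrix_(i, j) (d i * T i j / d j) = D *m T *m D'.
  by rewrite mul_mx_diag mul_diag_mx; apply/matrixP => i j; rewrite !mxE.
have uDP : D *m P \in unitmx by rewrite unitmx_mul uD.
apply: (can_inj (mulmxK uDP)); rewrite mulmxKV// /T !mulmxA.
by rewrite -[_ *m D' *m D]mulmxA D'D mulmx1 mulmxKV.
Qed.

Lemma hermitian_form_ge0 n (P : 'M[C]_n) : P^t* = P ->
    (forall (a : C) (x : 'cV[C]_n), x != 0 -> P *m x = a *: x ->
       a \is Num.real -> 0 <= a) ->
  forall x : 'cV[C]_n, 0 <= (x^t* *m P *m x) 0 0.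
Proof.
move=> PH eigP x.
have hP : P \is hermsymmx by apply/is_hermitianmxP; rewrite expr0 scale1r PH.
have := hermitian_spectral_diag_real hP => /mxOverP realP.
have /hermitian_normalmx/orthomx_spectralP PE := hP.
have uP := spectral_unit P; have unP := spectral_unitarymx P.
set V := spectralmx P in PE uP unP; set d := spectral_diag P in PE realP.
have d0 i : 0 <= d 0 i.
  apply: (eigP _ (col i (invmx V))) => //.
    apply: contraTneq isT => /(congr1 (mulmx V)).
    rewrite mulmx0 colE mulmxA mulmxV// mul1mx => /matrixP/(_ i 0).
    by rewrite !mxE !eqxx => /eqP; rewrite oner_eq0.
  rewrite {1}PE colE -!mulmxA (mulmxA V) mulmxV// mul1mx scalemxAr; congr mulmx.
  by rewrite mul_diag_mx; apply/matrixP => j k; rewrite !mxE;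
    case: eqP => [->//|]; rewrite ?mulr0.
rewrite PE invmx_unitary//.
have -> : x^t* *m (V^t* *m diag_mx d *m V) *m x
       = (V *m x)^t* *m diag_mx d *m (V *m x).
  by rewrite trmx_mul map_mxM !mulmxA.
rewrite mxE sumr_ge0// => i _; rewrite mul_mx_diag !mxE mulrAC mulrC.
by rewrite mulr_ge0// mulrC mul_conjC_ge0.
Qed.

(** In the coordinates of [stable_numrange], pair the Lyapunov equation with an
    eigenvector of P for a negative eigenvalue: the first two terms contribute a
    positive number and N a nonnegative one, so they cannot add up to 0. *)
Lemma lyapunov_hermitian_ge0 n (F P N : 'M[C]_n) :
    (forall a, root (char_poly F) a -> a + a^* < 0) -> P^t* = P ->
    (forall x : 'cV[C]_n, 0 <= (x^t* *m N *m x) 0 0) ->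
    F^t* *m P + P *m F + N = 0 ->
  forall x : 'cV[C]_n, 0 <= (x^t* *m P *m x) 0 0.
Proof.
move=> rootF PH N0 lyap.
have [W uW nrW] := stable_numrange rootF.
pose V := invmx W; pose P' := V^t* *m P *m V.
suff P'0 (x : 'cV_n) : 0 <= (x^t* *m P' *m x) 0 0.
  move=> x; have := P'0 (W *m x).
  rewrite /P' !mulmxA -[_ *m V *m W *m x]mulmxA -[_ *m V *m (W *m x)]mulmxA mulKmx//.
  by rewrite -map_mxM -trmx_mul mulKmx.
apply: hermitian_form_ge0 => {x}.
  by rewrite /P' !trmx_mul !map_mxM trmxCK PH mulmxA.
(* At an eigenvector x for a, the Lyapunov equation equates a times twice the
   real part of q with minus the form of N. *)
move=> a x x0 P'x ar; have := nrW x x0.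
set q := _ 0 0 => /= q0.
have qP : a * (q + q^*) = - ((V *m x)^t* *m N *m (V *m x)) 0 0.
  have PFq : ((V *m x)^t* *m (P *m F) *m (V *m x)) 0 0 = a * q.
    have -> : (V *m x)^t* *m (P *m F) *m (V *m x)
            = (P' *m x)^t* *m (W *m F *m invmx W) *m x.
      rewrite /P' !trmx_mul !map_mxM trmxCK PH !mulmxA.
      by rewrite -[_ *m V^t* *m P *m V *m W]mulmxA mulVmx// mulmx1.
    rewrite P'x linearZ /= map_mxZ -!scalemxAl mxE.
    by congr (_ * _); apply/CrealP.
  have FPq : ((V *m x)^t* *m (F^t* *m P) *m (V *m x)) 0 0 = a * q^*.
    rewrite -[in RHS](CrealP ar) -rmorphM /= -PFq sesqui_formJ.
    by rewrite [(P *m F)^T]trmx_mul map_mxM PH.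
  have : ((V *m x)^t* *m (F^t* *m P + P *m F + N) *m (V *m x)) 0 0 = 0.
    by rewrite lyap mulmx0 mul0mx mxE.
  rewrite mulmxDr mulmxDl mxE mulmxDr mulmxDl [X in X + _]mxE FPq PFq.
  by move/eqP; rewrite addr_eq0 => /eqP <-; rewrite mulrDr addrC.
rewrite real_leNgt ?real0//; apply/negP => a0.
have : 0 < a * (q + q^*) by rewrite nmulr_lgt0.
by rewrite qP oppr_gt0 => /lt_geF; rewrite N0.
Qed.

End Complex.

Section Real.
Variable R : realType.
Local Notation toC := (real_complex R).
Local Notation form P x := ((x^T *m P *m x) 0 0).

(** * Hurwitz real matrices in terms of real vectors *)

(** A complex eigenvector of a real matrix is used only through its real and
    imaginary parts, so that quadratic forms can stay real. *)
Lemma mulmx_complex n m (F : 'M[R]_(m, n)) (z : 'cV[R[i]]_n) :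
  map_mx toC F *m z =
  map_mx toC (F *m map_mx (@complex.Re R) z) +
  (Complex 0 1 : R[i]) *: map_mx toC (F *m map_mx (@complex.Im R) z).
Proof.
rewrite -[z in LHS](_ : map_mx toC (map_mx (@complex.Re R) z) +
  (Complex 0 1 : R[i]) *: map_mx toC (map_mx (@complex.Im R) z) = z).
  by rewrite mulmxDr -scalemxAr -!map_mxM.
by apply/matrixP => i j; rewrite !mxE -complexE.
Qed.

Lemma char_poly_trmx (S : comNzRingType) n (F : 'M[S]_n) : char_poly F^T = char_poly F.
Proof.
rewrite /char_poly -det_tr /char_poly_mx linearB /= tr_scalar_mx map_trmx.
by rewrite trmxK.
Qed.

Lemma complex_vec n (x y : 'cV[R]_n) :
  let z := map_mx toC x + (Complex 0 1 : R[i]) *: map_mx toC y in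
  map_mx (@complex.Re R) z = x /\ map_mx (@complex.Im R) z = y.
Proof.
split; apply/matrixP => i j; rewrite !mxE /=;
by rewrite !(mul0r, mul1r, mulr0, subr0, addr0, add0r).
Qed.

(** The two vector equations are the real and imaginary parts of
    F (x + i y) = (a + i b) (x + i y).  Stability is used and
    proved in this form, on pairs of real vectors. *)
Lemma hurwitzP n (F : 'M[R]_n) : hurwitz (char_poly F) <->
  forall (a b : R) (x y : 'cV[R]_n), (x != 0) || (y != 0) ->
    F *m x = a *: x - b *: y -> F *m y = b *: x + a *: y -> a < 0.
Proof.
split=> [hF a b x y xy0 Fx Fy | hF z].
  rewrite -[a]/(complex.Re (Complex a b)); apply: hF.
  rewrite map_char_poly -char_poly_trmx -eigenvalue_root_char.
  pose z := map_mx toC x + (Complex 0 1 : R[i]) *: map_mx toC y.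
  have [zx zy] := complex_vec x y.
  apply/eigenvalueP; exists z^T.
    rewrite -trmx_mul mulmx_complex zx zy -linearZ /=; congr trmx.
    rewrite Fx Fy; apply/matrixP => i j; rewrite !mxE.
    apply/eqP; rewrite eq_complex /=.
    by apply/andP; split; apply/eqP; ring.
  apply: contraL xy0 => /eqP z0; rewrite negb_or !negbK.
  have {}z0 : z = 0 by rewrite -[z]trmxK z0 trmx0.
  rewrite -/z z0 in zx zy; rewrite -zx -zy.
  by apply/andP; split; apply/eqP/matrixP => i j; rewrite !mxE.
rewrite map_char_poly -char_poly_trmx -eigenvalue_root_char => /eigenvalueP[v vF v0].
have Fv : map_mx toC F *m v^T = z *: v^T.
  by rewrite -[X in X *m _]trmxK -trmx_mul vF linearZ.
move: Fv; rewrite mulmx_complex.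
set x := map_mx (@complex.Re R) _; set y := map_mx (@complex.Im R) _.
have [ReF ImF] := complex_vec (F *m x) (F *m y) => Fv.
apply: (hF _ (complex.Im z) x y).
- apply: contraNT v0; rewrite negb_or !negbK => /andP[/eqP x0 /eqP y0].
  apply/eqP/matrixP => i j; apply/eqP; rewrite eq_complex.
  have := congr1 (fun A : 'cV_n => A j i) y0; have := congr1 (fun A : 'cV_n => A j i) x0.
  by rewrite !mxE /= => -> ->; rewrite eqxx.
- rewrite -[LHS]ReF Fv; apply/matrixP => i j; rewrite !mxE.
  by case: (z) (v j i) => ? ? [].
- rewrite -[LHS]ImF Fv; apply/matrixP => i j; rewrite !mxE addrC.
  by case: (z) (v j i) => ? ? [].
Qed.

(** * Real quadratic forms and Lyapunov's theorem *)

Lemma mx11D (M N : 'M[R]_1) : (M + N) 0 0 = M 0 0 + N 0 0.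
Proof. by rewrite mxE. Qed.

Lemma mx11N (M : 'M[R]_1) : (- M) 0 0 = - M 0 0.
Proof. by rewrite mxE. Qed.

Lemma mx11Z t (M : 'M[R]_1) : (t *: M) 0 0 = t * M 0 0.
Proof. by rewrite mxE. Qed.

Lemma trmx11 (M : 'M[R]_1) : M^T = M.
Proof. by apply/matrixP => i j; rewrite !ord1 mxE. Qed.

Lemma qformD n (P Q : 'M[R]_n) (x : 'cV_n) : form (P + Q) x = form P x + form Q x.
Proof. by rewrite mulmxDr mulmxDl mxE. Qed.

Lemma qformN n (P : 'M[R]_n) (x : 'cV_n) : form (- P) x = - form P x.
Proof. by rewrite mulmxN mulNmx mxE. Qed.

Lemma qform_congr m n (S : 'M[R]_(m, n)) (W : 'M_m) (x : 'cV_n) :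
  form (S^T *m W *m S) x = form W (S *m x).
Proof. by rewrite trmx_mul !mulmxA. Qed.

Lemma sqnormE n (y : 'cV[R]_n) : (y^T *m y) 0 0 = \sum_i y i 0 ^+ 2.
Proof. by rewrite mxE; apply: eq_bigr => i _; rewrite mxE expr2. Qed.

Lemma sqnorm_eq0 n (y : 'cV[R]_n) : (y^T *m y) 0 0 = 0 -> y = 0.
Proof.
rewrite sqnormE => /eqP; rewrite psumr_eq0 => [/allP y0|i _]; last exact: sqr_ge0.
apply/colP => i; rewrite mxE; apply/eqP; rewrite -sqrf_eq0.
exact: (implyP (y0 i (mem_index_enum i))).
Qed.

Lemma posdef_psd n (P : 'M[R]_n) : posdefmx P -> possemidefmx P.
Proof.
case=> PT P0; split=> // x; have [->|x0] := eqVneq x 0; last exact/ltW/P0.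
by rewrite mulmx0 mxE.
Qed.

Lemma psdD n (P Q : 'M[R]_n) : possemidefmx P -> possemidefmx Q -> possemidefmx (P + Q).
Proof.
move=> [PT P0] [QT Q0]; split=> [|x]; first by rewrite linearD /= PT QT.
by rewrite qformD addr_ge0.
Qed.

Lemma psd_congr m n (S : 'M[R]_(m, n)) (W : 'M_m) :
  possemidefmx W -> possemidefmx (S^T *m W *m S).
Proof.
move=> [WT W0]; split=> [|x]; last by rewrite qform_congr.
by rewrite !trmx_mul trmxK WT mulmxA.
Qed.

(** Otherwise P would be negative at x - t P x for a small t > 0. *)
Lemma psd_form_eq0 n (P : 'M[R]_n) (x : 'cV_n) :
  possemidefmx P -> form P x = 0 -> P *m x = 0.
Proof.
move=> [PT P0] Px0; apply: sqnorm_eq0; set y := P *m x; set c := _ 0 0.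
have c0 : 0 <= c by rewrite /c sqnormE sumr_ge0// => i _; rewrite sqr_ge0.
pose d := form P y.
have d0 : 0 <= d := P0 y.
have yPx : (y^T *m P *m x) 0 0 = c by rewrite -mulmxA.
have xPy : (x^T *m P *m y) 0 0 = c.
  by rewrite /c {2}/y trmx_mul PT.
have expand t : form P (x + t *: y) = t * c *+ 2 + t ^+ 2 * d.
  rewrite [(x + _)^T]linearD /= [(_ *: y)^T]linearZ /= !mulmxDl !mulmxDr.
  by rewrite -!scalemxAl -!scalemxAr !(mx11D, mx11Z) Px0 yPx xPy -/d; ring.
(* The value t = c / (d + 1) makes the expansion negative unless c = 0. *)
have d1 : 0 < d + 1 by rewrite ltr_wpDl.
have := P0 (x - (c / (d + 1)) *: y); rewrite -scaleNr expand => h.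
apply/eqP; rewrite -sqrf_eq0 eq_le sqr_ge0 andbT.
have : 0 <= (d + 1) ^+ 2 * (- (c / (d + 1)) * c *+ 2 + (- (c / (d + 1))) ^+ 2 * d).
  by rewrite mulr_ge0// sqr_ge0.
have -> : (d + 1) ^+ 2 * (- (c / (d + 1)) * c *+ 2 + (- (c / (d + 1))) ^+ 2 * d) =
   - (d + 2) * c ^+ 2 by field; rewrite gt_eqF.
rewrite mulNr oppr_ge0 pmulr_rle0// ltr_wpDl//.
Qed.

Lemma posdef_unit n (W : 'M[R]_n) : posdefmx W -> W \in unitmx.
Proof.
move=> [WT W0]; rewrite -row_free_unit -kermx_eq0; apply: contraT => /rowV0Pn[v].
move=> /sub_kermxP vW v0; suff: 0 < form W v^T.
  by rewrite trmxK vW mul0mx mxE ltxx.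
apply: W0; apply: contraNneq v0 => v0; by rewrite -[v]trmxK v0 trmx0.
Qed.

Lemma complexified_form n (P : 'M[R]_n) (z : 'cV[R[i]]_n) : P^T = P ->
  (map_mx Num.conj z^T *m map_mx toC P *m z) 0 0 =
  toC (form P (map_mx (@complex.Re R) z) + form P (map_mx (@complex.Im R) z)).
Proof.
move=> PT; rewrite -mulmxA mulmx_complex.
set x := map_mx (@complex.Re R) z; set y := map_mx (@complex.Im R) z.
have -> : map_mx Num.conj z^T = map_mx toC x^T - (Complex 0 1 : R[i]) *: map_mx toC y^T.
  apply/matrixP => i j; rewrite !mxE; apply/eqP; rewrite eq_complex /=.
  by case: (z j i) => ? ? /=; apply/andP; split; apply/eqP; ring.
rewrite mulmxDl mulmxDr mulNmx -!scalemxAl mulmxDr -!scalemxAr -!map_mxM.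
rewrite -!mulmxA.
have -> : y^T *m (P *m x) = x^T *m (P *m y).
  by rewrite -[LHS]trmx11 !trmx_mul trmxK PT -mulmxA.
set p := x^T *m (P *m x); set q := x^T *m _; set r := y^T *m _.
clearbody p q r.
rewrite !mxE; apply/eqP; rewrite eq_complex /=.
by apply/andP; split; apply/eqP; ring.
Qed.

(** Descent of the Hermitian statement along the inclusion of the reals into
    the complex numbers. *)
Lemma lyapunov_psd n (F P N : 'M[R]_n) : hurwitz (char_poly F) -> P^T = P ->
  possemidefmx N -> F^T *m P + P *m F + N = 0 -> possemidefmx P.
Proof.
move=> hF PT [NT N0] lyap; split=> // x.
have conj_toC k l (M : 'M[R]_(k, l)) : map_mx Num.conj (map_mx toC M) = map_mx toC M.
  by apply/matrixP => i j; rewrite !mxE; exact: conjc_real.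
have rootF (a : R[i]) : root (char_poly (map_mx toC F)) a -> a + Num.conj a < 0.
  rewrite -map_char_poly => /hF; rewrite ltcE /=.
  by case: a => u v /= u0; rewrite addrN eqxx /= -(addr0 0) ltrD.
have PH : map_mx Num.conj (map_mx toC P)^T = map_mx toC P.
  by rewrite map_trmx conj_toC PT.
have N0' (z : 'cV[R[i]]_n) : 0 <= (map_mx Num.conj z^T *m map_mx toC N *m z) 0 0.
  by rewrite complexified_form// ler0c addr_ge0.
have lyap' : map_mx Num.conj (map_mx toC F)^T *m map_mx toC P
    + map_mx toC P *m map_mx toC F + map_mx toC N = 0.
  by rewrite map_trmx conj_toC -!map_mxM -!map_mxD lyap map_mx0.
have := lyapunov_hermitian_ge0 rootF PH N0' lyap' (map_mx toC x).
by rewrite map_trmx conj_toC -!map_mxM mxE ler0c.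
Qed.

(** * Stability of closed loops and uniqueness for Riccati equations *)

(** A LaSalle-type criterion.  Evaluating the Lyapunov equation on an
    eigenvector v of F for an eigenvalue with nonnegative real part forces
    v^* N v = 0; there F agrees with the Hurwitz matrix G, so v is also an
    eigenvector of G, which is absurd.  Both policy improvement and the
    stabilizing property of Riccati solutions are instances. *)
Lemma lyapunov_hurwitz n (F G P N : 'M[R]_n) :
    possemidefmx P -> possemidefmx N -> F^T *m P + P *m F + N = 0 ->
    hurwitz (char_poly G) ->
    (forall x : 'cV_n, form N x = 0 -> F *m x = G *m x) ->
  hurwitz (char_poly F).
Proof.
move=> psdP psdN lyap /hurwitzP hG FG; apply/hurwitzP => a b x y xy0 Fx Fy.
have [PT P0] := psdP; have [NT N0] := psdN.
rewrite ltNge; apply/negP => a0.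
have sym (u v : 'cV[R]_n) : (u^T *m (P *m v)) 0 0 = (v^T *m (P *m u)) 0 0.
  by rewrite -[in LHS](trmx11 (_ *m _)) !trmx_mul trmxK PT -mulmxA.
have formF (u : 'cV[R]_n) : (u^T *m (P *m (F *m u))) 0 0 *+ 2 + form N u = 0.
  transitivity (form (F^T *m P + P *m F + N) u); last first.
    by rewrite lyap mulmx0 mul0mx mxE.
  rewrite !qformD; congr (_ + _); rewrite mulr2n -{1}sym trmx_mul.
  by rewrite !mulmxA.
have := formF x; rewrite Fx; have := formF y; rewrite Fy.
rewrite !(mulmxDr, mulmxN) -!scalemxAr !(mx11D, mx11N, mx11Z) (sym y x) => ey ex.
have Px : 0 <= (x^T *m (P *m x)) 0 0 by rewrite mulmxA.
have Py : 0 <= (y^T *m (P *m y)) 0 0 by rewrite mulmxA.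
have aPx := mulr_ge0 a0 Px; have aPy := mulr_ge0 a0 Py.
have Nx := N0 x; have Ny := N0 y.
have Nx0 : form N x = 0 by lra.
have Ny0 : form N y = 0 by lra.
have := hG a b x y xy0; rewrite -!FG// => /(_ Fx Fy).
by rewrite ltNge a0.
Qed.

(** A common root z would satisfy Re z < 0 and Re (- z) < 0. *)
Lemma coprime_spectra n (F G : 'M[R]_n) : hurwitz (char_poly F) ->
  hurwitz (char_poly G) -> coprimep (char_poly G) (char_poly (- F)).
Proof.
move=> hF hG; rewrite -(coprimep_map toC) /coprimep.
apply: contraT => /closed_rootP[z]; rewrite root_gcd => /andP[/hG Gz].
rewrite map_char_poly -eigenvalue_root_char => /eigenvalueP[v vF v0].
suff: complex.Re (- z) < 0 by case: (z) Gz => u w /= ? ; lra.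
apply: hF; rewrite map_char_poly -eigenvalue_root_char; apply/eigenvalueP.
exists v => //; rewrite scaleNr -vF -mulmxN; congr (_ *m _).
by apply/matrixP => i j; rewrite !mxE rmorphN opprK.
Qed.

(** The equation gives X p(G) = p(- F^T) X for every polynomial p.  For p the
    characteristic polynomial of G the left side vanishes by Cayley-Hamilton,
    while p(- F^T) is invertible by a Bezout relation with the characteristic
    polynomial of - F^T. *)
Lemma sylvester_inj n (F G X : 'M[R]_n) : hurwitz (char_poly F) ->
  hurwitz (char_poly G) -> F^T *m X + X *m G = 0 -> X = 0.
Proof.
case: n F G X => [|n] F G X; first by rewrite [X]flatmx0.
move=> hF hG /eqP; rewrite addrC addr_eq0 -mulNmx => /eqP XG.
have := @coprime_spectra _ F^T G; rewrite char_poly_trmx => /(_ hF hG).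
case/Bezout_coprimepP => -[u v] /= /eqpP[[c d] /= /andP[c0 d0]].
rewrite alg_polyC => Bez.
have XGp p : X *m horner_mx G p = horner_mx (- F^T) p *m X.
  elim/poly_ind: p => [|p k IH]; first by rewrite !rmorph0 mulmx0 mul0mx.
  rewrite !rmorphD !rmorphM /= !horner_mx_X !horner_mx_C.
  rewrite mulmxDr mulmxDl scalar_mxC; congr (_ + _).
  by rewrite -!mulmxE mulmxA IH -!mulmxA XG.
have pX : horner_mx (- F^T) (char_poly G) *m X = 0.
  by rewrite -XGp Cayley_Hamilton mulmx0.
have := congr1 (fun p => horner_mx (- F^T) p *m X) Bez.
rewrite /= linearZ /= rmorphD !rmorphM /= Cayley_Hamilton mulr0 addr0.
rewrite -scalemxAl -mulmxE -mulmxA pX mulmx0 scaler0 horner_mx_C mul_scalar_mx.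
by move/esym/eqP; rewrite scaler_eq0 (negPf d0) => /eqP.
Qed.

Lemma posdef_form_eq0 n (W : 'M[R]_n) (u : 'cV_n) : posdefmx W -> form W u = 0 -> u = 0.
Proof.
move=> [_ W0] Wu; apply/eqP; apply: contraT => /W0.
by rewrite Wu ltxx.
Qed.

(** The feedback minimizing the Hamiltonian of the control problem with value
    matrix X. *)
Definition gain n m (B : 'M[R]_(n, m)) (W : 'M_m) (X : 'M_n) : 'M[R]_(m, n) :=
  invmx W *m B^T *m X.

(** The Riccati operator is the Lyapunov operator of its own closed loop: this
    converts solutions of one equation into solutions of the other. *)
Lemma riccati_closed_loopE n m (A : 'M[R]_n) (B : 'M_(n, m)) Q W X :
    posdefmx W -> X^T = X -> let K := gain B W X in
  (A - B *m K)^T *m X + X *m (A - B *m K) + (Q + K^T *m W *m K)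
  = A^T *m X + X *m A + Q - X *m B *m invmx W *m B^T *m X.
Proof.
move=> pW XT K; have uW := posdef_unit pW; have [WT _] := pW.
have KT : K^T = X *m B *m invmx W by rewrite !trmx_mul trmxK trmx_inv XT WT mulmxA.
rewrite linearB /= trmx_mul KT mulmxBl mulmxBr mulmxKV// /K /gain !mulmxA.
set a := A^T *m X; set b := X *m A; set c := X *m B *m _ *m _ *m X.
clearbody a b c.
by apply/matrixP => i j; rewrite !mxE; ring.
Qed.

(** Where the running cost vanishes both C x and the feedback vanish, so the
    closed loop agrees there with the Hurwitz matrix A - E C. *)
Lemma riccati_stabilizing n m p (A : 'M[R]_n) (B : 'M_(n, m)) (C : 'M_(p, n))
    (E : 'M_(n, p)) W Qy X :
    posdefmx W -> posdefmx Qy -> hurwitz (char_poly (A - E *m C)) ->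
    possemidefmx X -> riccati A B (C^T *m Qy *m C) W X ->
  hurwitz (char_poly (A - B *m gain B W X)).
Proof.
move=> pW pQ hE psdX ric; have [XT _] := psdX.
have pC := psd_congr C (posdef_psd pQ).
have pK := psd_congr (gain B W X) (posdef_psd pW).
apply: (lyapunov_hurwitz psdX _ (etrans (riccati_closed_loopE _ _ _ pW XT) ric) hE).
  exact: psdD.
move=> x; rewrite qformD !qform_congr => /eqP.
rewrite paddr_eq0 ?(posdef_psd pQ).2 ?(posdef_psd pW).2// => /andP[/eqP Cx /eqP Kx].
rewrite !mulmxBl -(mulmxA B) -(mulmxA E).
by rewrite (posdef_form_eq0 pQ Cx) (posdef_form_eq0 pW Kx) !mulmx0.
Qed.

(** Subtracting the two equations gives
    (A - B K_X)^T (X - Y) + (X - Y) (A - B K_Y) = 0. *)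
Lemma riccati_unique n m p (A : 'M[R]_n) (B : 'M_(n, m)) (C : 'M_(p, n))
    (E : 'M_(n, p)) W Qy X Y :
    posdefmx W -> posdefmx Qy -> hurwitz (char_poly (A - E *m C)) ->
    possemidefmx X -> riccati A B (C^T *m Qy *m C) W X ->
    possemidefmx Y -> riccati A B (C^T *m Qy *m C) W Y -> X = Y.
Proof.
move=> pW pQ hE pX rX pY rY.
have hX := riccati_stabilizing pW pQ hE pX rX.
have hY := riccati_stabilizing pW pQ hE pY rY.
apply/eqP; rewrite -subr_eq0; apply/eqP; apply: (sylvester_inj hX hY).
have [XT _] := pX; have [WT _] := pW.
rewrite /gain [(A - _)^T]linearB /= !trmx_mul trmxK trmx_inv XT WT.
rewrite !(mulmxBl, mulmxBr) !mulmxA -[RHS](subrr 0) -{1}rX -rY.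
set a := A^T *m X; set b := A^T *m Y; set c := X *m A; set d := Y *m A.
set e := X *m B *m _ *m _ *m X; set f := X *m B *m _ *m _ *m Y.
set g := Y *m B *m _ *m _ *m Y.
set h := C^T *m Qy *m C.
clearbody a b c d e f g h.
by apply/matrixP => i j; rewrite !mxE; ring.
Qed.

(** * Policy iteration *)

(** The Lyapunov operator, written as a matrix acting on vectorized matrices,
    is inverted explicitly; a total solution function allows the iteration
    below to be defined by plain recursion. *)
Definition lyapunov_sol n (F N : 'M[R]_n) : 'M[R]_n :=
  vec_mx (mxvec (- N) *m invmx (lin_mulmx F^T + lin_mulmxr F)).

(** In finite dimension the injectivity of the Lyapunov operator gives
    surjectivity. *)
Lemma lyapunov_solP n (F N : 'M[R]_n) : hurwitz (char_poly F) ->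
  F^T *m lyapunov_sol F N + lyapunov_sol F N *m F + N = 0.
Proof.
move=> hF; set L := lin_mulmx F^T + lin_mulmxr F.
have LE X : mxvec X *m L = mxvec (F^T *m X + X *m F).
  by rewrite mulmxDr !mul_vec_lin linearD.
have uL : L \in unitmx.
  rewrite -row_free_unit -kermx_eq0; apply: contraT => /rowV0Pn[v].
  move=> /sub_kermxP vL /negP[]; apply/eqP.
  rewrite -[v]vec_mxK in vL *; rewrite LE in vL.
  suff -> : vec_mx v = 0 by rewrite linear0.
  by apply: (sylvester_inj hF hF); apply: (can_inj mxvecK); rewrite vL linear0.
apply/eqP; rewrite addr_eq0; apply/eqP; apply: (can_inj mxvecK).
by rewrite -LE vec_mxK mulmxKV.
Qed.

(** The transpose of the solution solves the same equation, hence symmetry;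
    positivity is then Lyapunov's theorem. *)
Lemma lyapunov_sol_psd n (F N : 'M[R]_n) : hurwitz (char_poly F) -> possemidefmx N ->
  possemidefmx (lyapunov_sol F N).
Proof.
move=> hF psdN; have lyapE := lyapunov_solP N hF; have [NT _] := psdN.
apply: (lyapunov_psd hF _ psdN lyapE).
apply/subr0_eq/(sylvester_inj hF hF).
have lyapE' : (lyapunov_sol F N)^T *m F + F^T *m (lyapunov_sol F N)^T + N = 0.
  by rewrite -[RHS]trmx0 -lyapE !linearD /= !trmx_mul trmxK NT.
rewrite mulmxBl mulmxBr -[RHS](subrr 0) -{1}lyapE' -lyapE.
move: (lyapunov_sol F N) => P.
move: (F^T *m P^T) (P^T *m F) (F^T *m P) (P *m F) => a b c d.
by apply/matrixP => i j; rewrite !mxE; ring.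
Qed.

Section Newton.
Variables (n m : nat) (A : 'M[R]_n) (B : 'M[R]_(n, m)) (Q : 'M[R]_n) (W : 'M[R]_m).
Hypotheses (pQ : possemidefmx Q) (pW : posdefmx W).

(** When the closed loop is stable, this is the value matrix of the constant
    feedback K: the integral over time of its running cost. *)
Definition policy_cost (K : 'M[R]_(m, n)) : 'M[R]_n :=
  lyapunov_sol (A - B *m K) (Q + K^T *m W *m K).

Lemma psd_running_cost (K : 'M[R]_(m, n)) : possemidefmx (Q + K^T *m W *m K).
Proof. by apply: psdD => //; apply/psd_congr/posdef_psd. Qed.

Lemma policy_cost_psd (K : 'M[R]_(m, n)) :
  hurwitz (char_poly (A - B *m K)) -> possemidefmx (policy_cost K).
Proof. by move=> hK; apply: lyapunov_sol_psd => //; exact: psd_running_cost. Qed.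

(** Completing the square: the cost of K, seen along the improved closed loop,
    satisfies a Lyapunov equation with the extra source term
    (K - K')^T W (K - K').  This term yields both stability of the new loop and
    monotonicity of the cost. *)
Lemma policy_improvement_eq (K : 'M[R]_(m, n)) :
  hurwitz (char_poly (A - B *m K)) ->
  let P := policy_cost K in let K' := gain B W P in
  (A - B *m K')^T *m P + P *m (A - B *m K')
    + (Q + K'^T *m W *m K' + (K - K')^T *m W *m (K - K')) = 0.
Proof.
move=> hK P K'; have uW := posdef_unit pW; have [WT _] := pW.
have [PT _] : possemidefmx P := policy_cost_psd hK.
have WK : W *m K' = B^T *m P by rewrite /K' /gain -mulmxA mulKVmx.
have KW : K'^T *m W = P *m B by rewrite -[W in LHS]WT -trmx_mul WK trmx_mul trmxK PT.
clearbody K'.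
rewrite -[RHS](lyapunov_solP (Q + K^T *m W *m K) hK) -/(policy_cost K) -/P.
rewrite ![(_ - _)^T]linearB /= !trmx_mul !(mulmxBl, mulmxBr) KW.
rewrite -!(mulmxA _ W K') WK !mulmxA -(mulmxA _ B^T) -(mulmxA _ B^T).
set a := A^T *m P; set b := P *m A; set c := P *m B *m K; set d := P *m B *m K'.
rewrite !mulmxA.
set e := K'^T *m B^T *m P; set f := K^T *m B^T *m P.
set g := K^T *m W *m K.
have -> : e = d by rewrite /e -mulmxA -WK mulmxA KW.
clearbody a b c d f g.
by apply/matrixP => i j; rewrite !mxE; ring.
Qed.

(** On vectors where the extra source term vanishes, K x = K' x, so the new
    closed loop agrees with the old one and [lyapunov_hurwitz] applies.  The
    difference of the costs solves the Lyapunov equation with that term as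
    source. *)
Lemma policy_improvement (K : 'M[R]_(m, n)) :
  hurwitz (char_poly (A - B *m K)) ->
  let K' := gain B W (policy_cost K) in
  hurwitz (char_poly (A - B *m K')) /\
  possemidefmx (policy_cost K - policy_cost K').
Proof.
move=> hK K'; have lyapE := policy_improvement_eq hK.
rewrite /= -/K' in lyapE.
have psdP := policy_cost_psd hK.
have psdD' : possemidefmx ((K - K')^T *m W *m (K - K')).
  exact/psd_congr/posdef_psd.
have psdK' := psd_running_cost K'.
have hK' : hurwitz (char_poly (A - B *m K')).
  apply: (lyapunov_hurwitz psdP _ lyapE hK) => [|x]; first exact: psdD.
  rewrite qformD => /eqP; rewrite paddr_eq0 ?psdD'.2 ?psdK'.2// => /andP[_ /eqP].
  rewrite qform_congr => /(posdef_form_eq0 pW) Kx.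
  apply/subr0_eq; rewrite -mulmxBl opprB addrC addrA subrK.
  by rewrite -mulmxBr -mulmxA Kx mulmx0.
split=> //.
have lyapE' := lyapunov_solP (Q + K'^T *m W *m K') hK'.
rewrite -/(policy_cost K') in lyapE'.
have [P'T _] := policy_cost_psd hK'.
apply: (lyapunov_psd hK' _ psdD'); first by rewrite linearB /= P'T psdP.1.
rewrite mulmxBl mulmxBr -[RHS](subrr 0) -{1}lyapE -lyapE'.
set F := A - B *m K'; move: (policy_cost K) (policy_cost K') => P P'.
move: (F^T *m P) (F^T *m P') (P *m F) (P' *m F) => a b c d.
move: (Q + _) ((K - K')^T *m W *m (K - K')) => e f.
by apply/matrixP => i j; rewrite !mxE; ring.
Qed.

End Newton.

(** * Monotone limits, existence and definiteness for Riccati equations *)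

Local Open Scope classical_set_scope.

(** Convergence is taken entrywise, which is compatible with products of
    matrices of any sizes, empty ones included. *)
Definition mxcvg m n (u : nat -> 'M[R]_(m, n)) (M : 'M[R]_(m, n)) : Prop :=
  forall i j, (fun k => u k i j) @ \oo --> M i j.

Lemma mxcvg_cst m n (M : 'M[R]_(m, n)) : mxcvg (fun=> M) M.
Proof. by move=> i j; exact: cvg_cst. Qed.
Arguments mxcvg_cst {m n} M.

Lemma mxcvgD m n (u v : nat -> 'M[R]_(m, n)) M N :
  mxcvg u M -> mxcvg v N -> mxcvg (fun k => u k + v k) (M + N).
Proof.
move=> uM vN i j; rewrite mxE; under eq_fun do rewrite mxE.
exact: cvgD.
Qed.

Lemma mxcvgN m n (u : nat -> 'M[R]_(m, n)) M :
  mxcvg u M -> mxcvg (fun k => - u k) (- M).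
Proof.
by move=> uM i j; rewrite mxE; under eq_fun do rewrite mxE; exact: cvgN.
Qed.

Lemma mxcvg_tr m n (u : nat -> 'M[R]_(m, n)) M :
  mxcvg u M -> mxcvg (fun k => (u k)^T) M^T.
Proof. by move=> uM i j; rewrite mxE; under eq_fun do rewrite mxE; exact: uM. Qed.

Lemma mxcvgM m n p (u : nat -> 'M[R]_(m, n)) (v : nat -> 'M[R]_(n, p)) M N :
  mxcvg u M -> mxcvg v N -> mxcvg (fun k => u k *m v k) (M *m N).
Proof.
move=> uM vN i j; rewrite mxE; under eq_fun do rewrite mxE.
apply: cvg_big => [|l _]; first exact: add_continuous.
exact: cvgM.
Qed.

Lemma mxcvg_unique m n (u : nat -> 'M[R]_(m, n)) M N :
  mxcvg u M -> mxcvg u N -> M = N.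
Proof.
by move=> uM uN; apply/matrixP => i j; apply: norm_cvg_unique (uM i j) (uN i j).
Qed.

Lemma form_cvg n (u : nat -> 'M[R]_n) M (x : 'cV_n) :
  mxcvg u M -> (fun k => form (u k) x) @ \oo --> form M x.
Proof. by move=> uM; exact: (mxcvgM (mxcvgM (mxcvg_cst x^T) uM) (mxcvg_cst x)). Qed.

Lemma entry_polarization n (P : 'M[R]_n) i j : P^T = P ->
  let e k : 'cV[R]_n := delta_mx k 0 in
  P i j = (form P (e i + e j) - form P (e i) - form P (e j)) / 2.
Proof.
move=> PT e.
have formE k l : ((e k)^T *m P *m e l) 0 0 = P k l.
  by rewrite trmx_delta -rowE -colE !mxE.
rewrite [(_ + _)^T]linearD /= !(mulmxDl, mulmxDr) !mx11D !formE.
have -> : P j i = P i j by rewrite -[in LHS]PT mxE.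
by field.
Qed.

(** Each quadratic form decreases and is bounded below by 0, and polarization
    recovers the entries from the forms. *)
Lemma psd_monotone_cvg n (u : nat -> 'M[R]_n) :
    (forall k, possemidefmx (u k)) ->
    (forall k, possemidefmx (u k - u k.+1)) ->
  exists2 M, possemidefmx M & mxcvg u M.
Proof.
move=> u0 uS.
have form_is_cvg (x : 'cV_n) : cvgn (fun k => form (u k) x).
  apply: nonincreasing_is_cvgn.
    apply/nonincreasing_seqP => k; have := (uS k).2 x.
    by rewrite qformD qformN subr_ge0.
  by exists 0 => _ [k _ <-]; exact: (u0 k).2.
pose M := \matrix_(i, j) limn (fun k => u k i j).
have uM : mxcvg u M.
  move=> i j; rewrite mxE; rewrite -/(cvgn _).
  under eq_fun do rewrite (entry_polarization _ _ (u0 _).1).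
  apply: is_cvgMr_tmp; do 2 ?apply: is_cvgB; exact: form_is_cvg.
exists M => //; split=> [|x].
  apply: (mxcvg_unique _ uM); have := mxcvg_tr uM.
  by under [X in mxcvg X]eq_fun do rewrite (u0 _).1.
rewrite -(cvg_lim _ (@form_cvg _ _ _ x uM))//; apply: limr_ge; first exact: form_is_cvg.
by apply: nearW => k; exact: (u0 k).2.
Qed.
Local Close Scope classical_set_scope.

(** The limit of the costs satisfies the Lyapunov equation of the closed loop
    given by its own gain, which is the Riccati equation. *)
Lemma riccati_exists n m (A : 'M[R]_n) (B : 'M[R]_(n, m)) Q W :
    possemidefmx Q -> posdefmx W -> stabilizable A B ->
  exists2 P, possemidefmx P & riccati A B Q W P.
Proof.
move=> pQ pW [K0 hK0].
pose K k := iter k (fun K => gain B W (policy_cost A B Q W K)) K0.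
pose P k := policy_cost A B Q W (K k).
have hK k : hurwitz (char_poly (A - B *m K k)).
  by elim: k => [//|k IH]; exact: (policy_improvement pQ pW IH).1.
have [P_ psdP PP] : exists2 M, possemidefmx M & mxcvg P M.
  apply: psd_monotone_cvg => k; first exact: policy_cost_psd.
  exact: (policy_improvement pQ pW (hK k)).2.
exists P_ => //.
(* Index k.+1 is used because the gain K k.+1 is the one computed from P k. *)
have PS : mxcvg (fun k => P k.+1) P_.
  by move=> i j; have := PP i j; rewrite -(cvg_shiftS (fun k => P k i j)).
have KS : mxcvg (fun k => K k.+1) (gain B W P_).
  have h := mxcvgM (mxcvg_cst (invmx W *m B^T)) PP.
  exact: h.
set K_ := gain B W P_ in KS.
have lim0 : (A - B *m K_)^T *m P_ + P_ *m (A - B *m K_) + (Q + K_^T *m W *m K_) = 0.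
  have AS : mxcvg (fun k => A - B *m K k.+1) (A - B *m K_).
    exact: (mxcvgD (mxcvg_cst A) (mxcvgN (mxcvgM (mxcvg_cst B) KS))).
  have QS : mxcvg (fun k => Q + (K k.+1)^T *m W *m K k.+1) (Q + K_^T *m W *m K_).
    exact: (mxcvgD (mxcvg_cst Q) (mxcvgM (mxcvgM (mxcvg_tr KS) (mxcvg_cst W)) KS)).
  have := mxcvgD (mxcvgD (mxcvgM (mxcvg_tr AS) PS) (mxcvgM PS AS)) QS.
  move/mxcvg_unique; apply; move=> i j.
  by under eq_fun do rewrite lyapunov_solP//; exact: cvg_cst.
by rewrite /riccati -riccati_closed_loopE// psdP.1.
Qed.

(** Evaluating the Riccati equation on the kernel of P shows that this kernel is
    contained in that of C and invariant under A, hence killed by the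
    observability matrix. *)
Lemma riccati_posdef n m p (A : 'M[R]_n) (B : 'M_(n, m)) (C : 'M_(p, n)) W Qy P :
    posdefmx W -> posdefmx Qy -> observable A C ->
    possemidefmx P -> riccati A B (C^T *m Qy *m C) W P -> posdefmx P.
Proof.
move=> pW pQ obs psdP ric; have [PT P0] := psdP; split=> // x x0.
rewrite lt_def P0 andbT; apply: contraNneq x0 => Px0.
have ker (z : 'cV_n) : P *m z = 0 -> C *m z = 0 /\ P *m (A *m z) = 0.
  move=> Pz; have zP : z^T *m P = 0.
    by rewrite -[P]PT -trmx_mul Pz trmx0.
  have Cz : C *m z = 0.
    apply: (posdef_form_eq0 pQ); rewrite -qform_congr.
    transitivity (form (A^T *m P + P *m A + C^T *m Qy *m C
       - P *m B *m invmx W *m B^T *m P) z).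
      rewrite !qformD qformN !mulmxA zP !mul0mx -!mulmxA Pz !mulmx0.
      by rewrite (mxE _ (fun _ _ => 0)) oppr0 addr0 !add0r.
    by rewrite ric mulmx0 mul0mx mxE.
  split=> //; have := congr1 (mulmx^~ z) ric.
  rewrite /= mulmxBl !mulmxDl -!mulmxA Pz Cz !mulmx0 mul0mx.
  by rewrite add0r addr0 subr0.
have kerA i : P *m (A ^+ i *m x) = 0.
  elim: i => [|i IH]; first by rewrite expr0 mul1mx; exact: psd_form_eq0.
  by rewrite exprS -mulmxE -mulmxA; exact: (ker _ IH).2.
have Ox : observability_mx A C *m x = 0.
  rewrite mxcol_mul -[RHS]mxcol0; apply: eq_mxcol => i.
  by rewrite -mulmxA; exact: (ker _ (kerA i)).1.
have full : row_full (observability_mx A C) by rewrite /row_full obs.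
by rewrite -[x]mul1mx -(mulVpmx full) -mulmxA Ox mulmx0.
Qed.

(** * Companion blocks *)

Lemma char_poly_companion n (q : {poly R}) : q \is monic -> size q = n.+1 ->
  char_poly (companion n q) = q.
Proof.
move=> qm sq; have -> : n = (size q).-1 by rewrite sq.
rewrite -[RHS](companionmxK qm); congr char_poly.
apply/matrixP => i j; rewrite !mxE.
by congr (if _ then _ else _); case: (_.-1) i {j} => [[]//|d i]; rewrite eqSS.
Qed.

Lemma mxtens_sum k n (f : 'I_k -> 'I_n -> R) :
  \sum_(l < k * n) f (mxtens_unindex l).1 (mxtens_unindex l).2
  = \sum_i \sum_j f i j.
Proof.
rewrite pair_big (reindex (@mxtens_index k n)); last first.
  by exists (@mxtens_unindex k n) => ? _; rewrite (mxtens_indexK, mxtens_unindexK).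
by apply: eq_bigr => ij _; rewrite mxtens_indexK.
Qed.

(** The Kronecker product with an identity acts blockwise, so some nonzero block
    of an eigenvector is an eigenvector of F. *)
Lemma hurwitz_tens1mx k n (F : 'M[R]_n) : hurwitz (char_poly F) ->
  hurwitz (char_poly ((1%:M : 'M[R]_k) *t F)).
Proof.
move=> /hurwitzP hF; apply/hurwitzP => a b x y xy0 Fx Fy.
pose blk (z : 'cV[R]_(k * n)) i : 'cV[R]_n := \col_j z (mxtens_index (i, j)) 0.
have blk_mul z i : F *m blk z i = blk ((1%:M *t F) *m z) i.
  apply/colP => j; rewrite !mxE.
  pose g i' j' := (i == i')%:R * F j j' * z (mxtens_index (i', j')) 0.
  transitivity (\sum_l g (mxtens_unindex l).1 (mxtens_unindex l).2); last first.
    apply: eq_bigr => l _.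
    by rewrite mxE mxtens_indexK mxE /g -surjective_pairing mxtens_unindexK.
  rewrite mxtens_sum (bigD1 i)//= [X in _ + X]big1 ?addr0.
    by apply: eq_bigr => j' _; rewrite /g eqxx mul1r mxE.
  move=> i' /negPf i'i; apply: big1 => j' _.
  by rewrite /g eq_sym i'i !mul0r.
have blk0 z : z != 0 -> exists i, blk z i != 0.
  move=> z0; apply/existsP; apply: contraNT z0 => /existsPn z0.
  apply/eqP/colP => l.
  have /eqP/colP/(_ (mxtens_unindex l).2) := negbNE (z0 (mxtens_unindex l).1).
  by rewrite !mxE -surjective_pairing mxtens_unindexK.
have [i xyi] : exists i, (blk x i != 0) || (blk y i != 0).
  by case/orP: xy0 => /blk0[i zi]; exists i; rewrite zi ?orbT.
apply: (hF a b (blk x i) (blk y i)) => //; rewrite blk_mul ?Fx ?Fy.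
  by apply/colP => j; rewrite !mxE.
by apply/colP => j; rewrite !mxE.
Qed.

Lemma horner_eq0_poly_eq0 (p : {poly R}) : (forall s, p.[s] = 0) -> p = 0.
Proof.
move=> p0; apply: (@roots_geq_poly_eq0 _ p [seq i%:R | i <- iota 0 (size p)]).
- by apply/allP => s _; apply/rootP.
- by rewrite map_inj_uniq ?iota_uniq//; apply: mulrIn; rewrite oner_eq0.
- by rewrite size_map size_iota.
Qed.

(** Indexing the coefficients by all natural numbers, with zeros beyond the
    degree, spares the recursion a case distinction at its upper end. *)
Definition coeff_mx n (D : 'I_n -> 'M[R]_n) (j : nat) : 'M[R]_n :=
  if insub j is Some i then D i else 0.

(** Both sides of (s I - F) (sum_j D_j s^j) = Lambda(s) I are polynomial in s.
    The hypothesis gives the equality outside the roots of Lambda, so after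
    multiplication by Lambda it holds everywhere, and coefficients can be
    compared. *)
Lemma resolvent_recursion n (F : 'M[R]_n) (D : 'I_n -> 'M[R]_n) :
    (forall s : R, (char_poly F).[s] != 0 ->
       invmx (s%:M - F) = (char_poly F).[s]^-1 *: \sum_(j < n) s ^+ j *: D j) ->
  forall i : nat, (if i is j.+1 then coeff_mx D j else 0) =
    F *m coeff_mx D i + ((char_poly F)`_i)%:M.
Proof.
move=> hD; set q := char_poly F in hD *.
have q0 : q != 0 by rewrite monic_neq0 ?char_poly_monic.
have detq s : \det (s%:M - F) = q.[s].
  rewrite -horner_evalE -det_map_mx; congr (\det _).
  apply/matrixP => i j; rewrite /char_poly_mx !mxE /= /horner_eval.
  by rewrite hornerD hornerN hornerMn hornerX hornerC.
pose S s := \sum_(j < n) s ^+ j *: D j.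
have key s : q.[s] != 0 -> (s%:M - F) *m S s = q.[s]%:M.
  move=> qs; have uX : s%:M - F \in unitmx by rewrite unitmxE detq unitfE.
  have -> : S s = q.[s] *: invmx (s%:M - F) by rewrite hD// scalerA divff// scale1r.
  by rewrite -scalemxAr mulmxV// scalemx1.
pose p k l : {poly R} := 'X * \poly_(j < n) (coeff_mx D j k l)
  - \poly_(j < n) ((F *m coeff_mx D j) k l) - q *+ (k == l).
have DE (j : 'I_n) : coeff_mx D j = D j by rewrite /coeff_mx valK.
have p0 k l : p k l = 0.
  suff /eqP : p k l * q = 0 by rewrite mulf_eq0 (negPf q0) orbF => /eqP.
  apply: horner_eq0_poly_eq0 => s; rewrite hornerM.
  have [->|qs] := eqVneq q.[s] 0; first by rewrite mulr0.
  have := congr1 (fun M : 'M_n => M k l) (key s qs).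
  rewrite mulmxBl mul_scalar_mx mxE [X in _ + X]mxE [X in X - _]mxE.
  rewrite [RHS]mxE /S mulmx_sumr !summxE => e.
  rewrite /p !hornerE hornerMn !horner_poly -e.
  apply/eqP; rewrite mulf_eq0; apply/orP; left; apply/eqP.
  have -> : \sum_(i < n) coeff_mx D i k l * s ^+ i = \sum_(i < n) (s ^+ i *: D i) k l.
    by apply: eq_bigr => i _; rewrite DE mxE mulrC.
  have -> : \sum_(i < n) (F *m coeff_mx D i) k l * s ^+ i =
      \sum_(i < n) (F *m (s ^+ i *: D i)) k l.
    by apply: eq_bigr => i _; rewrite DE -scalemxAr [in RHS]mxE mulrC.
  by rewrite subrr.
move=> i; apply/matrixP => k l.
have D0 j : (n <= j)%N -> coeff_mx D j = 0.
  by move=> nj; rewrite /coeff_mx insubF// ltnNge nj.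
have := congr1 (fun r : {poly R} => r`_i) (p0 k l).
rewrite /p !coefB coefXM coef0 coefMn !coef_poly => e.
rewrite [RHS]mxE [X in _ + X]mxE.
apply/eqP; rewrite -subr_eq0; apply/eqP; rewrite -[RHS]e opprD addrA.
congr (_ - _ - _).
  case: i {e} => [|i]/=; first by rewrite mxE.
  by case: ltnP => // ni; rewrite D0// mxE.
by case: ltnP => // ni; rewrite D0// mulmx0 mxE.
Qed.

(** * The parametrization intertwines the two systems *)

Lemma B_zetaE n m p (l : 'I_((m + p) * n)) (c : 'I_m) :
  B_zeta R n m p l c =
  ((mxtens_unindex l).1 == lshift p c)%:R * last_col R n (mxtens_unindex l).2 0.
Proof.
rewrite castmxE mxE; set l' := cast_ord _ l.
have vl' : nat_of_ord l' = l by [].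
have l2 : (mxtens_unindex l).2 = (l' %% n)%N :> nat by [].
rewrite -val_eqE /= [in RHS]mxE l2.
case: split_ordP => k lk.
  rewrite mxE !mxE -val_eqE /= divn1.
  by rewrite -vl' lk.
rewrite mxE (_ : (l %/ n)%N == c = false) ?mul0r//.
rewrite -vl' lk /=; apply/negbTE; rewrite neq_ltn; apply/orP; right.
rewrite divnMDl; last by case: (n) k {lk l l' vl' l2} => // -[]; rewrite muln0.
by rewrite (leq_trans (ltn_ord c))// leq_addr.
Qed.

Lemma zeta_outE n m p (l : 'I_((m + p) * n)) (c : 'I_p) :
  zeta_out R n m p l c =
  ((mxtens_unindex l).1 == rshift m c)%:R * last_col R n (mxtens_unindex l).2 0.
Proof.
rewrite castmxE mxE; set l' := cast_ord _ l.
have vl' : nat_of_ord l' = l by [].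
have l2 : (mxtens_unindex l).2 = (l' %% n)%N :> nat by [].
rewrite -val_eqE /= [in RHS]mxE l2.
case: split_ordP => k lk.
  rewrite mxE (_ : (l %/ n)%N == (m + c)%N = false) ?mul0r//.
  rewrite -vl' lk /=; apply/negbTE; rewrite neq_ltn; apply/orP; left.
  rewrite (@leq_trans m) ?leq_addr// ltn_divLR ?ltn_ord//.
  by case: (n) k {lk l l' vl' l2} => // -[]; rewrite muln0.
have n0 : (0 < n)%N by case: (n) k {lk l l' vl' l2} => // -[]; rewrite muln0.
rewrite mxE !mxE -val_eqE /= divn1.
by rewrite -vl' lk /= divnMDl// eqn_add2l modnMDl.
Qed.

(** The recursion says that right multiplication of the block row
    [D_0, ..., D_(n-1)] by the companion matrix is left multiplication by F. *)
Lemma companion_shift n (F : 'M[R]_n) (D : 'I_n -> 'M[R]_n) (q : {poly R}) :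
    q \is monic -> size q = n.+1 ->
    (forall i : nat, (if i is j.+1 then coeff_mx D j else 0) =
      F *m coeff_mx D i + (q`_i)%:M) ->
  (forall j, \sum_i companion n q i j *: D i = F *m D j) /\
  (forall i : 'I_n, i.+1 == n -> D i = 1%:M).
Proof.
move=> qm sq rec.
have DE (j : 'I_n) : coeff_mx D j = D j by rewrite /coeff_mx valK.
have Dlast (i : 'I_n) : i.+1 == n -> D i = 1%:M.
  move=> /eqP iE; have := rec i.+1; rewrite DE => ->.
  rewrite /coeff_mx insubF ?iE ?ltnn// mulmx0 add0r.
  by have := monicP qm; rewrite lead_coefE sq /= => ->.
split=> // j; have := rec j; rewrite DE => recj.
rewrite -[RHS](addrK (q`_j)%:M) -recj.
have -> : \sum_i companion n q i j *: D i =
    \sum_(i < n) ((i.+1 == j :> nat)%:R *: D i - (i.+1 == n)%:R *: (q`_j)%:M).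
  apply: eq_bigr => i _; rewrite mxE; case: ifP => [iE|_].
    rewrite (eqP iE) gtn_eqF ?ltn_ord// scale0r add0r scale1r.
    by rewrite (Dlast _ iE) scalemx1 raddfN.
  by rewrite scale0r subr0.
rewrite big_split /= sumrN -scaler_suml; congr (_ - _).
  case: (nat_of_ord j) (ltn_ord j) => [_|k kn].
    by apply: big1 => i _; rewrite scale0r.
  have kn' := ltnW kn; rewrite /coeff_mx insubT /=.
  rewrite (bigD1 (Ordinal kn'))//= eqxx scale1r big1 ?addr0// => i ik.
  by rewrite eqSS; have /negPf := ik; rewrite -val_eqE /= => ->; rewrite scale0r.
have n0 : (n.-1 < n)%N by rewrite ltn_predL (leq_ltn_trans _ (ltn_ord j)).
rewrite (bigD1 (Ordinal n0))//= prednK ?eqxx ?(leq_ltn_trans _ (ltn_ord j))//.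
rewrite big1 ?addr0 ?scale1r// => i; rewrite -val_eqE /= => /negPf ik.
by rewrite -[X in _ == X](prednK (leq_ltn_trans (leq0n _) (ltn_ord j))) eqSS ik.
Qed.

Section Zeta.
Variables (n m p : nat) (A : 'M[R]_n) (B : 'M[R]_(n, m)) (C : 'M[R]_(p, n)).
Variables (L : 'M[R]_(n, p)) (D : 'I_n -> 'M[R]_n).
Hypothesis hD : resolvent_coeffs A C L D.

Let rec i : (if i is j.+1 then coeff_mx D j else 0) =
  (A - L *m C) *m coeff_mx D i + ((observer_poly A C L)`_i)%:M.
Proof.
apply: resolvent_recursion => s /hD <-; by rewrite opprB addrA addrAC.
Qed.

Let shift :
  (forall j, \sum_i companion n (observer_poly A C L) i j *: D i =
     (A - L *m C) *m D j) /\
  (forall i : 'I_n, i.+1 == n -> D i = 1%:M).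
Proof.
apply: companion_shift rec; first exact: char_poly_monic.
exact: size_char_poly.
Qed.

Let f i := col i (row_mx B L).

Lemma param_mx_companion :
  param_mx B L D *m ((1%:M : 'M_(m + p)) *t companion n (observer_poly A C L))
  = (A - L *m C) *m param_mx B L D.
Proof.
apply/matrixP => k l; rewrite mxE.
set i := (mxtens_unindex l).1; set j := (mxtens_unindex l).2.
transitivity (((A - L *m C) *m D j *m f i) k 0); last first.
  by rewrite -mulmxA mxE [RHS]mxE; apply: eq_bigr => h _; rewrite [param_mx _ _ _ _ _]mxE.
rewrite -shift.1.
pose g i' j' := (D j' *m f i') k 0 *
  ((i' == i)%:R * companion n (observer_poly A C L) j' j).
transitivity (\sum_l' g (mxtens_unindex l').1 (mxtens_unindex l').2).
  by apply: eq_bigr => l' _; rewrite mxE [X in _ * X]mxE [X in _ * (X * _)]mxE.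
rewrite mxtens_sum (bigD1 i)//= [X in _ + X]big1 ?addr0; last first.
  by move=> i' /negPf i'i; apply: big1 => j' _; rewrite /g i'i mul0r mulr0.
rewrite mulmx_suml summxE; apply: eq_bigr => j' _.
by rewrite /g eqxx mul1r -scalemxAl [RHS]mxE mulrC.
Qed.

(** Columns of E that are unit vectors at the last position of a block pick out
    the columns D_(n-1) f_i = f_i. *)
Let param_mx_last q (h : 'I_q -> 'I_(m + p)) (E : 'M[R]_((m + p) * n, q)) :
    (forall l c, E l c = ((mxtens_unindex l).1 == h c)%:R *
       last_col R n (mxtens_unindex l).2 0) ->
  forall k c, (param_mx B L D *m E) k c = row_mx B L k (h c).
Proof.
move=> hE k c; rewrite mxE.
pose g i' j' := (D j' *m f i') k 0 * ((i' == h c)%:R * last_col R n j' 0).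
transitivity (\sum_l' g (mxtens_unindex l').1 (mxtens_unindex l').2).
  by apply: eq_bigr => l' _; rewrite hE mxE.
rewrite mxtens_sum (bigD1 (h c))//= [X in _ + X]big1 ?addr0; last first.
  by move=> i' /negPf i'i; apply: big1 => j' _; rewrite /g i'i mul0r mulr0.
have n0 : (n.-1 < n)%N by rewrite ltn_predL (leq_ltn_trans _ (ltn_ord k)).
have lastE : (Ordinal n0).+1 == n by rewrite /= prednK// (leq_ltn_trans _ (ltn_ord k)).
rewrite (bigD1 (Ordinal n0))//= big1 ?addr0.
  by rewrite /g eqxx [last_col _ _ _ _]mxE lastE (shift.2 _ lastE) mul1mx !mulr1 mxE.
move=> j'; rewrite -val_eqE /= => /negPf j'n.
have j'n1 : (j'.+1 == n) = false by rewrite -[X in _ == X](eqP lastE).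
by rewrite /g [last_col _ _ _ _]mxE j'n1 !mulr0.
Qed.

Lemma param_mx_B_zeta : param_mx B L D *m B_zeta R n m p = B.
Proof.
apply/matrixP => k c; rewrite (param_mx_last (h := lshift p) (@B_zetaE n m p)).
by rewrite row_mxEl.
Qed.

Lemma param_mx_zeta_out : param_mx B L D *m zeta_out R n m p = L.
Proof.
apply/matrixP => k c; rewrite (param_mx_last (h := @rshift m p) (@zeta_outE n m p)).
by rewrite row_mxEr.
Qed.

Lemma param_mx_A_zeta :
  param_mx B L D *m A_zeta A B C L D = A *m param_mx B L D.
Proof.
by rewrite mulmxDr param_mx_companion mulmxA param_mx_zeta_out mulmxA -mulmxDl subrK.
Qed.

End Zeta.

End Real.

Theorem theorem2 (R : realType) (n m p : nat)
    (A : 'M[R]_n) (B : 'M[R]_(n, m)) (C : 'M[R]_(p, n)) (L : 'M[R]_(n, p))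
    (Ru : 'M[R]_m) (Qy : 'M[R]_p) (D : 'I_n -> 'M[R]_n)
    (hAB : stabilizable A B) (hAC : observable A C)
    (hL : hurwitz (observer_poly A C L))
    (hRu : posdefmx Ru) (hQy : posdefmx Qy)
    (hD : resolvent_coeffs A C L D) :
  let M := param_mx B L D in
  exists P : 'M[R]_n,
    unique (fun X => posdefmx X /\ riccati A B (C^T *m Qy *m C) Ru X) P /\
    unique (fun X => possemidefmx X /\
              riccati (A_zeta A B C L D) (B_zeta R n m p)
                (Q_zeta B C L D Qy) Ru X)
           (M^T *m P *m M).
Proof.
move=> M; have [P psdP ricP] := riccati_exists (psd_congr C (posdef_psd hQy)) hRu hAB.
have psdZ : possemidefmx (M^T *m P *m M) := psd_congr M psdP.
have ricZ : riccati (A_zeta A B C L D) (B_zeta R n m p) (Q_zeta B C L D Qy) Ru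
  (M^T *m P *m M).
  have MA : M *m A_zeta A B C L D = A *m M := param_mx_A_zeta B hD.
  have MB : M *m B_zeta R n m p = B := param_mx_B_zeta B hD.
  rewrite /riccati /Q_zeta -/M.
  move: (A_zeta A B C L D) (B_zeta R n m p) MA MB => Az Bz MA MB.
  have MAT : Az^T *m M^T = M^T *m A^T by rewrite -!trmx_mul MA.
  have MBT : Bz^T *m M^T = B^T by rewrite -trmx_mul MB.
  rewrite -[RHS](mul0mx _ M) -[0 in RHS](mulmx0 _ M^T) -[in RHS]ricP.
  rewrite !(mulmxDr, mulmxDl, mulmxN, mulNmx) !mulmxA MAT.
  by rewrite -!(mulmxA _ M) MA MB -(mulmxA _ Bz^T M^T) MBT !mulmxA.
exists P; split; split.
- by split=> //; exact: (riccati_posdef hRu hQy hAC psdP ricP).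
- move=> X [/posdef_psd psdX ricX].
  exact: (riccati_unique hRu hQy hL psdP ricP psdX ricX).
- by split.
- move=> X [psdX ricX].
  have QE : Q_zeta B C L D Qy = (C *m M)^T *m Qy *m (C *m M).
    by rewrite /Q_zeta trmx_mul !mulmxA.
  have hz : hurwitz (char_poly (A_zeta A B C L D - zeta_out R n m p *m (C *m M))).
    rewrite /A_zeta -/M addrK; apply: hurwitz_tens1mx.
    by rewrite char_poly_companion ?char_poly_monic ?size_char_poly.
  rewrite QE in ricZ ricX.
  exact: (riccati_unique hRu hQy hz psdZ ricZ psdX ricX).
Qed.
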